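(* Let $X,Y\subseteq\mathbb R^3$ be smooth tropical surfaces of degrees $d$ and $e$ respectively, intersecting transversally, and let $\mathcal C=X\cap Y$. Then $$\sum_{P\in\mathcal C^{(0)}}m_P=de(d+e),$$ where $\mathcal C^{(0)}$ is the set of vertices of $\mathcal C$ and $m_P$ the intersection multiplicity at $P$.
   Context: Over $(\mathbb R,\max,+)$, a tropical polynomial is $f(x)=\max_{a\in\mathcal A}\{\lambda_a+a\cdot x\}$, $\mathcal A\subseteq\mathbb Z^{m}$ finite, $\lambda_a\in\mathbb R$; Newton polytope $\Delta_f=\operatorname{conv}(\mathcal A)$; lifted polytope $\tilde\Delta_f=\operatorname{conv}\{(a,t):a\in\mathcal A,t\le\lambda_a\}$, whose bounded faces project to a regular lattice subdivision $\operatorname{Subdiv}(f)$ of $\Delta_f$. $V_{tr}(f)$ is the non-linear locus of $f$, a polyhedral complex of pure dimension $m-1$, with a bijection $C\mapsto C^\vee$ from $k$-cells of $V_{tr}(f)$ to $(m-k)$-cells of $\operatorname{Subdiv}(f)$, $C^\vee=\operatorname{conv}\{a:\lambda_a+a\cdot x=f(x)\}$ for $x$ in the relative interior of $C$. $V_{tr}(f)$ is smooth of degree $d$ if every maximal cell of $\operatorname{Subdiv}(f)$ is a lattice simplex of volume $1/m!$ and $\Delta_f=\Gamma^m_d:=\operatorname{conv}\{0,de_1,\dots,de_m\}$. For $X_i=V_{tr}(f_i)$, $i=1,\dots,n$, let $U=X_1\cup\dots\cup X_n=V_{tr}(f_1\odot\cdots\odot f_n)$ (the product polynomial has function $f_1+\dots+f_n$),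 and $\operatorname{Subdiv}_U=\operatorname{Subdiv}(f_1\odot\cdots\odot f_n)$. Since $\tilde\Delta_{f_1\odot\cdots\odot f_n}=\tilde\Delta_{f_1}+\dots+\tilde\Delta_{f_n}$, each bounded face decomposes uniquely as a Minkowski sum of bounded faces of the $\tilde\Delta_{f_i}$; projecting gives the privileged representation $\Lambda=\Lambda_1+\dots+\Lambda_n$ of each cell of $\operatorname{Subdiv}_U$. Each cell $C$ of $X_1\cap\dots\cap X_n$ is uniquely $C_1\cap\dots\cap C_n$ with $C_i$ a cell of $X_i$ containing $C$ in its relative interior; $C$ is a cell of $U$ and $C^\vee\in\operatorname{Subdiv}_U$ has privileged representation $C_1^\vee+\dots+C_n^\vee$. The intersection is transversal if for all $J\subseteq\{1,\dots,n\}$, $|J|\ge2$, $\bigcap_{i\in J}X_i$ has dimension $m-|J|$ and every cell $C$ of it satisfies $\dim C^\vee=\sum_{i\in J}\dim C_i^\vee$. When $n=m-1$ and the intersection $I$ is transversal (hence one-dimensional), the intersection multiplicity at a vertex $P$ of $I$ is $m_P=2\operatorname{vol}_m(P^\vee)$, with $P^\vee\in\operatorname{Subdiv}_U$. Here $m=3$, $n=2$. *)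

(* Defs.v *)
From HB Require Import structures.
From mathcomp Require Import all_boot all_order all_algebra.
From mathcomp Require Import all_classical all_reals all_analysis.
Set Implicit Arguments. Unset Strict Implicit. Unset Printing Implicit Defensive.
Import Order.TTheory GRing.Theory Num.Theory numFieldNormedType.Exports.
Local Open Scope classical_set_scope.
Local Open Scope ring_scope.

Section Trop.
Variable R : realType.

Definition pt := 'rV[R]_3.
Definition expo := 'rV[int]_3.

(** A tropical polynomial is a formal tropical sum  (+)_k  lambda_k (.) x^(a_k),
    given as the list of its terms (a_k, lambda_k).  Repeated exponents are
    allowed; they combine by tropical addition (max), exactly as in the
    max-plus semiring.  Its support A is the set of exponents occurring. *)
Definition trop_poly := seq (expo * R).

Definition zvec (a : expo) : pt := map_mx (fun z : int => z%:~R) a.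
Definition dotp (u v : pt) : R := \sum_(i < 3) u 0 i * v 0 i.

Definition term_val (t : expo * R) (x : pt) : R := t.2 + dotp (zvec t.1) x.

(** f(x) = max_k (lambda_k + a_k . x)  (the list is nonempty in our use) *)
Definition teval (f : trop_poly) (x : pt) : R :=
  \big[Num.max/(if f is t :: _ then term_val t x else 0)]_(t <- f) term_val t x.

Definition tprod (f g : trop_poly) : trop_poly :=
  [seq (t.1 + u.1, t.2 + u.2) | t <- f, u <- g].

Definition Vtr (f : trop_poly) : set pt :=
  [set x | ~ exists (grad : pt) (c : R),
             \forall y \near x, teval f y = c + dotp grad y].

Definition argmax (f : trop_poly) (x : pt) : seq expo :=
  [seq t.1 | t <- f & term_val t x == teval f x].

Definition conv (s : seq pt) : set pt :=
  [set x | exists w : nat -> R, (forall i, 0 <= w i) /\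
     \sum_(i < size s) w i = 1 /\ x = \sum_(i < size s) w i *: s`_i].

Definition newton (f : trop_poly) : set pt := conv [seq zvec t.1 | t <- f].

(** the cell of Subdiv(f) dual to the cell of V_tr(f) containing x in its
    relative interior: conv{a : lambda_a + a.x = f(x)}.  The cells of
    Subdiv(f) (projections of bounded faces of the lifted polytope) are
    exactly the sets  dual f x,  x in R^3. *)
Definition dual (f : trop_poly) (x : pt) : set pt :=
  conv [seq zvec a | a <- argmax f x].

Definition affdim_ge (S : set pt) (k : nat) : Prop :=
  exists p : 'I_k.+1 -> pt, (forall i, S (p i)) /\
    \rank (\matrix_(i < k, j < 3) (p (lift ord0 i) 0 j - p ord0 0 j)) = k.
Definition affdim (S : set pt) (k : nat) : Prop :=
  affdim_ge S k /\ ~ affdim_ge S k.+1.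

Definition to_pt (p : (R * R) * R) : pt :=
  \row_(i < 3) [:: p.1.1; p.1.2; p.2]`_i.
Definition vol3 (S : set pt) : \bar R :=
  (((@lebesgue_measure R \x @lebesgue_measure R) \x @lebesgue_measure R)
    (to_pt @^-1` S))%E.

Definition unimodular_simplex (S : set pt) : Prop :=
  exists a : 'I_4 -> expo,
    S = conv [seq zvec (a i) | i <- enum 'I_4] /\ affdim S 3 /\
    vol3 S = (1 / 6%:R)%:E.

Definition dvert (d : nat) (i : 'I_3) : pt := \row_j (if j == i then d%:R else 0).
Definition Gamma3 (d : nat) : set pt :=
  conv [:: 0; dvert d 0; dvert d 1; dvert d 2].

Definition smooth_deg (f : trop_poly) (d : nat) : Prop :=
  newton f = Gamma3 d /\
  forall x : pt,
    (forall y : pt, dual f x `<=` dual f y -> dual f y = dual f x) ->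
    unimodular_simplex (dual f x).

(** the relative interior of the cell of X_1 cap X_2 containing x: the common
    refinement of the cell structures of V_tr(f) and V_tr(g) *)
Definition stratum (f g : trop_poly) (x : pt) : set pt :=
  [set y | argmax f y =i argmax f x /\ argmax g y =i argmax g x].

Definition inter (f g : trop_poly) : set pt := Vtr f `&` Vtr g.

Definition trop_transversal (f g : trop_poly) : Prop :=
  ((forall x, inter f g x -> ~ affdim_ge (stratum f g x) 2) /\
   (exists x, inter f g x /\ affdim (stratum f g x) 1)) /\
  forall x, inter f g x -> forall n n1 n2 : nat,
    affdim (dual (tprod f g) x) n -> affdim (dual f x) n1 ->
    affdim (dual g x) n2 -> n = (n1 + n2)%N.

Definition curve_vertex (f g : trop_poly) (P : pt) : Prop :=
  inter f g P /\ affdim (stratum f g P) 0.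

Definition mult (f g : trop_poly) (P : pt) : \bar R :=
  (2%:E * vol3 (dual (tprod f g) P))%E.

End Trop.

(* Main.v *)
Require Import Defs.
From HB Require Import structures.
From mathcomp Require Import all_boot all_order all_algebra.
From mathcomp Require Import all_classical all_reals all_analysis.
From mathcomp Require Import measurable_realfun ring lra.
Import Order.TTheory GRing.Theory Num.Theory numFieldNormedType.Exports.
Local Open Scope classical_set_scope.
Local Open Scope ring_scope.

(** For a tropical polynomial h, the dual cells of the points of R^3 cover the
    Newton polytope of h: z lies in the cell dual to x as soon as x minimises
    h(x) - z . x.  Two distinct points have dual cells that overlap in a plane,
    so the volume of the Newton polytope is the sum of the volumes of the dual
    cells.  Apply this to f, to g and to their product.  A three-dimensional cell
    of the product is a translate of a cell of f, or of a cell of g, or is dual to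
    a vertex of the curve; by transversality no point of X cap Y has a
    three-dimensional dual cell in Subdiv(f) or in Subdiv(g).  Hence the cells
    dual to vertices of the curve have total volume
    ((d+e)^3 - d^3 - e^3)/6 = de(d+e)/2. *)

Set Implicit Arguments. Unset Strict Implicit. Unset Printing Implicit Defensive.

(** * Farkas' lemma and convex hulls *)

Section Farkas.
Context (R : realFieldType) (n : nat).
Local Notation dot u v := (\sum_(i < n) u 0 i * v 0 i).

(* [(c, b)] stands for the inequality [c . x <= b]. *)
Definition halfspace := ('rV[R]_n * R)%type.

Inductive cone (s : seq halfspace) : halfspace -> Prop :=
| cone0 : cone s 0
| coneD (t : R) c e : 0 <= t -> c \in s -> cone s e -> cone s (t *: c + e).

Lemma cone_add s c e : cone s c -> cone s e -> cone s (c + e).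
Proof.
move=> + ce; elim=> [|t c' e' t0 c's _ ih]; first by rewrite add0r.
by rewrite -addrA; apply: coneD.
Qed.

Lemma cone_scale s (t : R) c : 0 <= t -> cone s c -> cone s (t *: c).
Proof.
move=> t0; elim=> [|u c' e' u0 c's _ ih]; first by rewrite scaler0; apply: cone0.
by rewrite scalerDr scalerA; apply: coneD => //; apply: mulr_ge0.
Qed.

Lemma cone_mem s c : c \in s -> cone s c.
Proof.
by move=> cs; rewrite -[c]scale1r -[_ *: _]addr0; apply: coneD => //; exact: cone0.
Qed.

Lemma cone_trans s s' c : (forall e, e \in s' -> cone s e) -> cone s' c -> cone s c.
Proof.
move=> ss'; elim=> [|t c' e' t0 c's _ ih]; first exact: cone0.
by apply: cone_add => //; apply: cone_scale => //; apply: ss'.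
Qed.

(** Supplies a value for the eliminated variable between its lower and upper bounds; either list may
    be empty. *)
Lemma seq_separation (L H : seq R) :
  (forall l h, l \in L -> h \in H -> l <= h) ->
  exists t, (forall l, l \in L -> l <= t) /\ (forall h, h \in H -> t <= h).
Proof.
elim: L => [_|l L ih lh].
  elim: H => [|h H [t [_ ht]]]; first by exists 0.
  exists (Num.min h t); split => // k; rewrite inE => /predU1P[->|/ht kt].
    by rewrite ge_min lexx.
  by rewrite ge_min kt orbT.
have [|t [lt ht]] := ih.
  by move=> l' h' l'L; apply: lh; rewrite inE l'L orbT.
exists (Num.max l t); split => k.
  rewrite inE => /predU1P[->|/lt kt]; first by rewrite le_max lexx.
  by rewrite le_max kt orbT.
by move=> kH; rewrite ge_max ht // lh // mem_head.
Qed.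

(* Fourier-Motzkin elimination of the last coordinate that still occurs. *)
Lemma farkas_upto k (s : seq halfspace) :
  (forall c, c \in s -> forall i : 'I_n, (k <= i)%N -> c.1 0 i = 0) ->
  (exists x : 'rV_n, forall c, c \in s -> dot c.1 x <= c.2) \/
  (exists2 b, b < 0 & cone s (0, b)).
Proof.
elim: k s => [s s0|k ih s sk].
  case: (boolP (all (fun c : halfspace => 0 <= c.2) s)) => [/allP s_ge0|].
    left; exists 0 => c cs; rewrite big1 ?s_ge0// => i _.
    by rewrite mxE mulr0.
  case/allPn => c cs; rewrite -ltNge => c0; right; exists c.2 => //.
  suff -> : (0, c.2) = c by exact: cone_mem.
  rewrite [RHS]surjective_pairing; congr (_, _); apply/rowP => i.
  by rewrite s0 // mxE.
have [nk|kn] := leqP n k.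
  apply: ih => c cs i ki.
  by have := leq_trans nk ki; rewrite leqNgt ltn_ord.
pose j := Ordinal kn.
(* Cancels coordinate [j]; both factors are positive when the first inequality has a negative and
   the second a positive coefficient there. *)
pose comb (cd : halfspace * halfspace) : halfspace :=
  cd.2.1 0 j *: cd.1 + (- cd.1.1 0 j) *: cd.2.
pose N := [seq c : halfspace <- s | c.1 0 j < 0].
pose P := [seq c : halfspace <- s | c.1 0 j > 0].
pose s' := [seq c : halfspace <- s | c.1 0 j == 0] ++
    [seq comb (c, d) | c : halfspace <- N, d : halfspace <- P].
have [c'|[x xs']|[b b0 bs']] := ih s'.
- rewrite mem_cat => /orP[|/allpairsP[[c d]] /= []].
    rewrite mem_filter => /andP[/eqP cj cs] i.
    rewrite leq_eqVlt => /predU1P[ki|]; last exact: sk.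
    by rewrite (_ : i = j) //; apply: val_inj.
  rewrite !mem_filter => /andP[_ cs] /andP[_ ds] -> i.
  rewrite leq_eqVlt => /predU1P[ki|ki].
    by rewrite (_ : i = j) ?mxE /=; [ring|apply: val_inj].
  by rewrite /= !mxE (sk c cs i ki) (sk d ds i ki) !mulr0 addr0.
- left.
  have [|t [Lt Ht]] := @seq_separation
      [seq (c.2 - dot c.1 x) / c.1 0 j | c : halfspace <- N]
      [seq (c.2 - dot c.1 x) / c.1 0 j | c : halfspace <- P].
    move=> _ _ /mapP[c cN ->] /mapP[d dP ->].
    have : comb (c, d) \in s'.
      by rewrite mem_cat; apply/orP; right; apply/allpairsP; exists (c, d).
    move: cN dP; rewrite !mem_filter => /andP[c0 _] /andP[d0 _] /xs'.
    have -> : dot (comb (c, d)).1 x =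
        d.1 0 j * dot c.1 x - c.1 0 j * dot d.1 x.
      rewrite !mulr_sumr -sumrB; apply: eq_bigr => i _.
      by rewrite !mxE /=; ring.
    rewrite /= /GRing.scale /= => h.
    by rewrite ler_ndivrMr // mulrAC ler_pdivrMr //; lra.
  (* Moving [x] along coordinate [j] does not affect the inequalities free of that coordinate. *)
  exists (x + t *: delta_mx 0 j) => c cs.
  have -> : dot c.1 (x + t *: delta_mx 0 j) = dot c.1 x + t * c.1 0 j.
    under eq_bigr do rewrite !mxE mulrDr.
    rewrite big_split /=; congr (_ + _).
    rewrite (bigD1 j) //= big1 => [|i /negPf ij]; rewrite ?eqxx ?ij ?mulr0 //.
    by rewrite mulr1 addr0 mulrC.
  have [c0|c0|c0] := ltgtP (c.1 0 j) 0.
  + have /Lt : (c.2 - dot c.1 x) / c.1 0 j \in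
        [seq (c.2 - dot c.1 x) / c.1 0 j | c : halfspace <- N].
      by apply/mapP; exists c; rewrite // mem_filter c0.
    by rewrite ler_ndivrMr // lerBrDl.
  + have /Ht : (c.2 - dot c.1 x) / c.1 0 j \in
        [seq (c.2 - dot c.1 x) / c.1 0 j | c : halfspace <- P].
      by apply/mapP; exists c; rewrite // mem_filter c0.
    by rewrite ler_pdivlMr // lerBrDl.
  + by rewrite c0 mulr0 addr0; apply: xs'; rewrite mem_cat mem_filter c0 eqxx cs.
- right; exists b => //; apply: cone_trans bs' => c.
  rewrite mem_cat => /orP[|/allpairsP[[d e]] /= []].
    by rewrite mem_filter => /andP[_ /cone_mem].
  rewrite !mem_filter => /andP[d0 ds] /andP[e0 es] ->.
  apply: cone_add; apply: cone_scale; rewrite ?oppr_ge0 /= ?ltW //;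
    exact: cone_mem.
Qed.

Lemma farkas (s : seq halfspace) :
  (exists x : 'rV_n, forall c, c \in s -> dot c.1 x <= c.2) \/
  (exists2 b, b < 0 & cone s (0, b)).
Proof. by apply: (@farkas_upto n) => c _ i; rewrite leqNgt ltn_ord. Qed.

End Farkas.

(** * Convex hulls described by linear functionals *)

Section HullSupport.
Context (R : realType).
Implicit Types (s : seq (pt R)) (x y u v : pt R).

Lemma dotpC u v : dotp u v = dotp v u.
Proof. by apply: eq_bigr => i _; rewrite mulrC. Qed.
Lemma dotpDl u v x : dotp (u + v) x = dotp u x + dotp v x.
Proof. by rewrite -big_split; apply: eq_bigr => i _; rewrite mxE mulrDl. Qed.
Lemma dotpZl a u x : dotp (a *: u) x = a * dotp u x.
Proof. by rewrite mulr_sumr; apply: eq_bigr => i _; rewrite mxE mulrA. Qed.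
Lemma dotpNl u x : dotp (- u) x = - dotp u x.
Proof. by rewrite -scaleN1r dotpZl mulN1r. Qed.
Lemma dotpDr u v x : dotp x (u + v) = dotp x u + dotp x v.
Proof. by rewrite dotpC dotpDl !(dotpC x). Qed.
Lemma dotpZr a u x : dotp x (a *: u) = a * dotp x u.
Proof. by rewrite dotpC dotpZl dotpC. Qed.
Lemma dotpNr u x : dotp x (- u) = - dotp x u.
Proof. by rewrite dotpC dotpNl dotpC. Qed.
Lemma dotp0r x : dotp x 0 = 0.
Proof. by rewrite -(scale0r 0) dotpZr mul0r. Qed.

Lemma dotp_sumr (I : Type) (r : seq I) (F : I -> pt R) u :
  dotp u (\sum_(i <- r) F i) = \sum_(i <- r) dotp u (F i).
Proof.
by elim/big_rec2: _ => [|i ? ? _ <-]; rewrite ?dotp0r // dotpDr.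
Qed.

Lemma dotp_gt0 u : u != 0 -> 0 < dotp u u.
Proof.
move=> u0; have u_ge0 (i : 'I_3) : true -> 0 <= u 0 i * u 0 i.
  by rewrite -expr2 sqr_ge0.
rewrite lt_def sumr_ge0 // andbT; apply: contraNneq u0 => /(psumr_eq0P u_ge0) uu.
apply/eqP/rowP => i; rewrite mxE; apply/eqP.
by have /eqP := uu i isT; rewrite mulf_eq0 orbb.
Qed.

(** Collects a certificate against $v\cdot(a-x)\le-1$ into weights indexed by position, the format
    of [conv]. *)
Lemma cone_weights s x c : cone [seq (a - x, -1) | a <- s] c ->
  exists w : nat -> R, (forall i, 0 <= w i) /\
    c.1 = \sum_(i < size s) w i *: (s`_i - x) /\
    c.2 = - \sum_(i < size s) w i.
Proof.
elim=> [|t _ e t0 /mapP[a as_ ->] _ [w [w0 [e1 e2]]]].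
  exists (fun=> 0); split=> //; split; rewrite /= big1 ?oppr0 // => i _.
  by rewrite scale0r.
have js : (index a s < size s)%N by rewrite index_mem.
pose d i : R := if i == index a s then t else 0.
have dz (i : 'I_(size s)) : i != Ordinal js -> d i = 0.
  by rewrite /d => /negPf ij; case: eqP => // h; move: ij; rewrite -val_eqE /= h eqxx.
exists (fun i => d i + w i); split=> [i|].
  by rewrite addr_ge0 // /d; case: ifP.
split=> /=.
  under eq_bigr do rewrite scalerDl.
  rewrite big_split /= e1; congr (_ + _).
  rewrite (bigD1 (Ordinal js)) //= big1 => [|i /dz ->]; last by rewrite scale0r.
  by rewrite addr0 /d eqxx nth_index.
rewrite big_split /= e2 opprD; congr (_ + _).
rewrite (bigD1 (Ordinal js)) //= big1 => [|i /dz //].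
by rewrite addr0 /d eqxx /GRing.scale /= mulrN1.
Qed.

(** If [v] strictly separated [x] from [s], a weighted sum of positive gaps would vanish, and with
    it all weights. Conversely, a separating [v] could be scaled to a gap of 1; when no such [v]
    exists, Farkas' lemma returns weights of positive sum, which are normalised. *)
Lemma conv_support s x :
  Defs.conv s x <-> forall v, exists2 a, a \in s & dotp v x <= dotp v a.
Proof.
split=> [[w [w0 [w1 ->]]] v|h].
  apply: contrapT => /forall2NP sv.
  have lt i : (i < size s)%N -> dotp v s`_i < dotp v (\sum_(i < size s) w i *: s`_i).
    by move=> /(mem_nth 0) si; rewrite ltNge; apply/negP; case: (sv s`_i).
  set x0 := \sum_(i < size s) w i *: s`_i in lt.
  have wz : \sum_(i < size s) w i * (dotp v x0 - dotp v s`_i) = 0.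
    under eq_bigr do rewrite mulrBr.
    rewrite sumrB -mulr_suml w1 mul1r dotp_sumr.
    by under [X in X - _]eq_bigr do rewrite dotpZr; rewrite subrr.
  suff : \sum_(i < size s) w i = 0 by rewrite w1 => /eqP; rewrite oner_eq0.
  apply: big1 => i _.
  have /eqP : w i * (dotp v x0 - dotp v s`_i) = 0.
    have F0 (k : 'I_(size s)) : true -> 0 <= w k * (dotp v x0 - dotp v s`_k).
      by rewrite mulr_ge0 // subr_ge0 ltW ?lt.
    exact: (psumr_eq0P F0 wz).
  by rewrite mulf_eq0 subr_eq0 (gt_eqF (lt i _)) // orbF => /eqP.
have [[v vs]|[b b0]] := farkas [seq (a - x, -1) | a <- s].
  have [a as_ va] := h v.
  have /= := vs _ (map_f (fun a : pt R => (a - x, -1 : R)) as_).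
  rewrite -/(dotp _ _) dotpC dotpDr dotpNr; lra.
case/cone_weights => w [w0 [/= wx wb]].
pose W := \sum_(i < size s) w i.
have W0 : W != 0 by rewrite gt_eqF // -oppr_lt0 -wb.
exists (fun i => w i / W); split=> [i|].
  by rewrite divr_ge0 // -oppr_le0 -wb ltW.
rewrite -mulr_suml divff //; split=> //.
apply: (scalerI W0); rewrite scaler_sumr.
under eq_bigr do rewrite scalerA mulrC divfK //.
apply/eqP; rewrite eq_sym -subr_eq0 scaler_suml -sumrB [X in _ == X]wx.
by apply/eqP/eq_bigr => i _; rewrite scalerBr.
Qed.

Lemma eq_conv s s' : s =i s' -> Defs.conv s = Defs.conv s'.
Proof.
move=> ss'; apply/seteqP; split=> x /conv_support h; apply/conv_support => v;
  by have [a as_ va] := h v; exists a; rewrite // ?ss' // -ss'.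
Qed.

End HullSupport.

(** * Dual cells *)

Section TropicalPolynomials.
Context (R : realType).
Implicit Types (f g h : trop_poly R) (x y z v : pt R) (a b : expo) (t : expo * R).

Definition tight f x t := term_val t x == teval f x.

Lemma term_val_add t x v : term_val t (x + v) = term_val t x + dotp (zvec R t.1) v.
Proof. by rewrite /term_val dotpDr addrA. Qed.

Lemma zvecD a b : zvec R (a + b) = zvec R a + zvec R b.
Proof. by apply/rowP => i; rewrite !mxE rmorphD. Qed.

Lemma zvec_inj : injective (zvec R).
Proof.
move=> a b /rowP ab; apply/rowP => i.
by have := ab i; rewrite !mxE => /intr_inj.
Qed.

Lemma teval_ge f t x : t \in f -> term_val t x <= teval f x.
Proof.
move=> tf; pose x0 := if f is u :: _ then term_val u x else 0.
exact (@le_bigmax_seq _ _ _ f x0 t xpredT (fun u => term_val u x) tf isT).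
Qed.

Lemma tight_exists f x : f != [::] -> exists2 t, t \in f & tight f x t.
Proof.
rewrite /tight /teval; case: f => // t0 f _; rewrite big_seq.
(* The default of the maximum is the value of the first term, so it too is attained. *)
apply: (big_ind (fun r => exists2 t, t \in t0 :: f & term_val t x == r)).
- by exists t0; rewrite ?mem_head.
- move=> r r' [t tf /eqP <-] [t' t'f /eqP <-].
  by rewrite /Num.max; case: ifP => _; [exists t'|exists t].
- by move=> t tf; exists t.
Qed.

Lemma argmaxP f x a :
  reflect (exists2 t, t \in f & tight f x t /\ t.1 = a) (a \in argmax f x).
Proof.
apply: (iffP mapP) => [[t]|[t tf [tt <-]]].
  by rewrite mem_filter => /andP[tt tf] ->; exists t.
by exists t; rewrite // mem_filter tf andbT.
Qed.

Lemma argmax_exists f x : f != [::] -> exists a, a \in argmax f x.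
Proof.
by move=> /(tight_exists x)[t tf tt]; exists t.1; apply/argmaxP; exists t.
Qed.

(** The subgradient inequality holds in both directions. Exponents may repeat, so the terms
    attaining the two maxima need not coincide. *)
Lemma argmax_dotp f x y a : a \in argmax f x -> a \in argmax f y ->
  dotp (zvec R a) (y - x) = teval f y - teval f x.
Proof.
move=> /argmaxP[t tf [/eqP tx ta]] /argmaxP[u uf [/eqP uy ua]].
have := teval_ge y tf; have := teval_ge x uf.
rewrite -tx -uy /term_val ta ua dotpDr dotpNr; lra.
Qed.

Lemma argmax_le f x y a : a \in argmax f x ->
  dotp (zvec R a) (y - x) <= teval f y - teval f x.
Proof.
move=> /argmaxP[t tf [/eqP tx ta]].
have := teval_ge y tf.
rewrite -tx /term_val ta dotpDr dotpNr; lra.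
Qed.

Lemma argmax_ray f x v a (r : R) :
  teval f (x + r *: v) = teval f x + r * dotp (zvec R a) v ->
  a \in argmax f x -> a \in argmax f (x + r *: v).
Proof.
move=> h /argmaxP[t tf [/eqP tx ta]]; apply/argmaxP; exists t => //; split=> //.
by rewrite /tight term_val_add h tx ta dotpZr.
Qed.

Lemma dualP f x z : dual f x z <->
  forall v, exists2 a, a \in argmax f x & dotp v z <= dotp v (zvec R a).
Proof.
split=> [/conv_support h v|h]; last apply/conv_support => v.
  by have [_ /mapP[a af ->] va] := h v; exists a.
by have [a af va] := h v; exists (zvec R a); first exact: map_f.
Qed.

Lemma newtonP f z : newton f z <->
  forall v, exists2 t, t \in f & dotp v z <= dotp v (zvec R t.1).
Proof.
split=> [/conv_support h v|h]; last apply/conv_support => v.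
  by have [_ /mapP[a af ->] va] := h v; exists a.
by have [t tf va] := h v; exists (zvec R t.1); first by apply/mapP; exists t.
Qed.

Lemma dual_mem f x a : a \in argmax f x -> dual f x (zvec R a).
Proof. by move=> af; apply/dualP => v; exists a. Qed.

Lemma eq_dual f x y : argmax f x =i argmax f y -> dual f x = dual f y.
Proof. by move=> xy; apply: eq_conv; apply: eq_mem_map. Qed.

Lemma dual_newton f x : dual f x `<=` newton f.
Proof.
move=> z /dualP h; apply/newtonP => v.
by have [a /argmaxP[t tf [_ <-]] va] := h v; exists t.
Qed.

(* A point of two dual cells satisfies both subgradient inequalities. *)
Lemma dual_overlap f x y z : dual f x z -> dual f y z ->
  dotp (y - x) z = teval f y - teval f x.
Proof.
move=> /dualP/(_ (y - x))[a /(argmax_le y) ax xz].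
move=> /dualP/(_ (x - y))[b /(argmax_le x) ay yz].
move: ax xz ay yz; rewrite -[x - y]opprB !(dotpC (zvec _ _)) !dotpNl; lra.
Qed.

Lemma near_term_val_lt t u x : term_val t x < term_val u x ->
  \forall y \near x, term_val t y < term_val u y.
Proof.
move=> tu; have dist_cont : {for x, continuous (fun y => term_val u y - term_val t y)}.
  have coord_cont (i : 'I_3) (r : R) : {for x, continuous (fun y : pt R => r * y 0 i)}.
    apply: (@cvgMr R (pt R) (nbhs x)); exact: coord_continuous.
  have term_cont s : {for x, continuous (term_val s)}.
    apply: (@cvgD R _ (pt R) (nbhs x)); first exact: cvg_cst.
    have -> : dotp (zvec R s.1) = (fun y : pt R => zvec R s.1 0 0 * y 0 0 +
        (zvec R s.1 0 1 * y 0 1 + zvec R s.1 0 (inord 2) * y 0 (inord 2))).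
      apply/funext => y; rewrite /dotp !big_ord_recl big_ord0 addr0.
      by congr (_ + (_ + _)); congr (_ * _); congr (fun_of_matrix _ _ _);
        apply: val_inj; rewrite /= ?inordK.
    apply: (@cvgD R _ (pt R) (nbhs x)); first exact: coord_cont.
    by apply: (@cvgD R _ (pt R) (nbhs x)); exact: coord_cont.
  by apply: (@cvgB R _ (pt R) (nbhs x)); exact: term_cont.
have := cvgr_gt _ dist_cont 0; rewrite subr_gt0 => /(_ _ tu).
by apply: filterS => y; rewrite subr_gt0.
Qed.

(** A term that is not maximal at [x] stays strictly below a maximal one nearby, and there are
    finitely many terms. *)
Lemma near_tight f x : f != [::] ->
  \forall y \near x, forall t, t \in f -> tight f y t -> tight f x t.
Proof.
move=> /(tight_exists x)[u uf /eqP ux].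
(* Induction on a sublist [s], with tightness still measured against all of [f]. *)
suff : forall s : seq (expo * R), {subset s <= f} ->
    \forall y \near x, forall t, t \in s -> tight f y t -> tight f x t by apply.
elim=> [_|t s ih tsf]; first by apply: (@nearW _ (nbhs x)).
have /ih : {subset s <= f} by move=> r rs; rewrite tsf // inE rs orbT.
have [tx|tx] := boolP (tight f x t).
  apply: filterS => y h r; rewrite inE => /predU1P[->//|]; exact: h.
have tu : term_val t x < term_val u x.
  by rewrite ux lt_neqAle tx teval_ge // tsf // mem_head.
apply: filterS2 (near_term_val_lt tu) => y ty h r.
rewrite inE => /predU1P[->|]; last exact: h.
by rewrite /tight => /eqP ty'; have := teval_ge y uf; rewrite -ty' leNgt ty.
Qed.

Lemma near_argmax f x : f != [::] ->
  \forall y \near x, {subset argmax f y <= argmax f x}.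
Proof.
move=> /(near_tight x); apply: filterS => y h a /argmaxP[t tf [/h tx <-]].
by apply/argmaxP; exists t; rewrite // tx.
Qed.

Lemma near_ray (P : pt R -> Prop) x v : (\forall y \near x, P y) ->
  exists2 r : R, 0 < r & P (x + r *: v).
Proof.
move=> Px; have : x + r *: v @[r --> (0 : R)] --> x.
  rewrite -[X in _ --> X]addr0 -(scale0r v).
  by apply: cvgD; [exact: cvg_cst|apply: cvgZl; exact: cvg_id].
move=> /(_ _ Px)/nbhs_ballP[e /= e0 h]; exists (e / 2); first by rewrite divr_gt0.
apply: h; rewrite /ball /= sub0r normrN gtr0_norm ?divr_gt0 //; lra.
Qed.

(* If only exponent [a] is maximal at [x], then [f] is affine near [x]; conversely
   an affine germ dominating all maximal terms has each of them as gradient. *)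
Lemma VtrP f x : f != [::] -> Vtr f x <->
  exists a b, [/\ a \in argmax f x, b \in argmax f x & a != b].
Proof.
move=> f0; have [a af] := argmax_exists x f0.
split=> [Vx|[b [c [bf cf bc]]] [G [k Gx]]].
  apply: contrapT => sing; apply: Vx.
  have single b : b \in argmax f x -> b = a.
    by move=> bf; apply: contrapT => /eqP ba; apply: sing; exists b, a.
  exists (zvec R a), (teval f x - dotp (zvec R a) x).
  apply: filterS (near_argmax x f0) => y sub.
  have [b bf] := argmax_exists y f0.
  have := bf => /sub bx; have := argmax_dotp bx bf.
  by rewrite (single _ bx) dotpDr dotpNr => h; lra.
have Gmax e : e \in argmax f x -> zvec R e = G.
  move=> ef; apply/eqP; rewrite -subr_eq0; apply: contraT => /dotp_gt0.
  (* Along this direction the term of [e] outgrows the affine germ: the subgradient inequality would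
     force [r * dotp v v <= 0]. *)
  set v := zvec R e - G => v0.
  have [r r0 Gr] := near_ray v Gx.
  have := argmax_le (x + r *: v) ef; rewrite Gr (nbhs_singleton Gx).
  rewrite addrAC subrr add0r dotpZr dotpDr dotpZr.
  have : 0 < r * dotp v v by rewrite mulr_gt0.
  rewrite {1}/v dotpDl dotpNl mulrBr; lra.
by move/eqP: bc; apply; apply: zvec_inj; rewrite !Gmax.
Qed.

End TropicalPolynomials.

(** * Covering of the Newton polytope, products and dimension *)

Section DualSubdivision.
Context (R : realType).
Implicit Types (f g h : trop_poly R) (x y z v : pt R) (a b : expo) (t : expo * R).

(** [W] is the total weight of the combination. This makes an infeasibility certificate
    quantitative. *)
Lemma cone_relax n (s : seq (halfspace R n)) c : cone s c ->
  exists2 W, 0 <= W & forall (x : 'rV_n) (r : R),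
    (forall e, e \in s -> \sum_(i < n) e.1 0 i * x 0 i <= e.2 + r) ->
    \sum_(i < n) c.1 0 i * x 0 i <= c.2 + W * r.
Proof.
elim=> [|t d e t0 ds _ [W W0 ih]].
  by exists 0 => // x r _; rewrite mul0r addr0 big1 // => i _; rewrite mxE mul0r.
exists (t + W) => [|x r h]; first exact: addr_ge0.
have := ler_wpM2l t0 (h d ds); have := ih x r h.
rewrite mulr_sumr => h1 h2; rewrite /= mulrDl.
under eq_bigr do rewrite !mxE mulrDl -mulrA.
by rewrite big_split /=; move: h1 h2; rewrite /GRing.scale /= mulrDr; lra.
Qed.

(* [z] lies in the dual cell of any minimiser of [f(x) - z . x]; Farkas' lemma
   yields a minimiser because this function is bounded below. *)
Lemma dual_cover f z : newton f z -> exists x, dual f x z.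
Proof.
move=> /newtonP fz.
have f0 : f != [::] by have [t] := fz 0; case: (f).
pose phi x := teval f x - dotp z x.
(* The Newton condition in direction [x] yields a term whose coefficient is at most [phi x]. *)
have lb : has_lbound (range phi).
  exists (- \sum_(t <- f) `|t.2|) => _ [x _ <-].
  have [t tf] := fz x; rewrite !(dotpC x) /phi => zt.
  have := teval_ge x tf; rewrite /term_val.
  have : `|t.2| <= \sum_(t <- f) `|t.2| by rewrite (big_rem t) //= lerDl sumr_ge0.
  have := ler_norm (- t.2); rewrite normrN; lra.
have ge_m y : inf (range phi) <= phi y by apply: ge_inf => //; exists y.
pose m := inf (range phi); rewrite -/m in ge_m.
(* A point satisfying every [F t] has [phi x <= m], so it attains the infimum. *)
pose F t : halfspace R 3 := (zvec R t.1 - z, m - t.2).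
have Fdot t x : dotp (F t).1 x = term_val t x - t.2 - dotp z x.
  by rewrite dotpDl dotpNl /term_val; lra.
have [[x xm]|[b b0]] := farkas [seq F t | t <- f].
  have phi_x : phi x <= m.
    have [t tf /eqP tx] := tight_exists x f0.
    have := xm _ (map_f F tf); rewrite -/(dotp _ _) Fdot /phi -tx /=; lra.
  (* An exponent maximal just beyond [x] in direction [v] is maximal at [x] too, and minimality of
     [phi] at [x] bounds [dotp v z] by its slope. *)
  exists x; apply/dualP => v.
  have [r r0 sub] := near_ray v (near_argmax x f0).
  have [a av] := argmax_exists (x + r *: v) f0.
  exists a; first exact: sub.
  have := ge_m (x + r *: v); have := argmax_dotp (sub _ av) av.
  move: phi_x; rewrite /phi addrAC subrr add0r !dotpDr !dotpZr => h1 h2 h3.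
  by rewrite !(dotpC v) -(ler_pM2l r0); lra.
(* Loosening by [phi x - m] makes every inequality true at [x]. The certificate then bounds [phi]
   below by [m - b / W], which exceeds the infimum since [b < 0]. *)
case/cone_relax => W W0 /= hW.
have {}hW x : 0 <= b + W * (phi x - m).
  have := hW x (phi x - m); rewrite big1 => [|i _]; last by rewrite mxE mul0r.
  apply=> _ /mapP[t tf ->]; rewrite -/(dotp _ _) Fdot /=.
  by have := teval_ge x tf; rewrite /phi; lra.
have {}W0 : 0 < W.
  by rewrite lt_def W0 andbT; apply: contraTneq (hW 0) => ->; rewrite mul0r addr0 -ltNge.
have : m - b / W <= m.
  apply: lb_le_inf; first by exists (phi 0), 0.
  move=> _ [x _ <-]; rewrite -subr_ge0.
  have -> : phi x - (m - b / W) = (b + W * (phi x - m)) / W by field; rewrite gt_eqF.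
  by rewrite divr_ge0 // ltW.
have : b / W < 0 by rewrite pmulr_llt0 // invr_gt0.
lra.
Qed.

(** There are finitely many tightness patterns, and one point is chosen for each; a pattern that no
    point realises is sent to 0. Members of [S] may therefore share a cell, but such a cell is flat
    and has no volume. *)
Lemma cell_representatives f g : exists S : seq (pt R),
  uniq S /\ forall x, exists2 y, y \in S &
    argmax f y = argmax f x /\ argmax g y = argmax g x.
Proof.
pose code h x : (size h).-tuple bool := map_tuple (tight h x) (in_tuple h).
pose rep m := xget 0 [set x | (code f x, code g x) = m].
have argmax_code h x : argmax h x = [seq t.1 | t <- mask (code h x) h].
  by rewrite /argmax filter_mask.
exists (undup [seq rep m | m <- enum {: (size f).-tuple bool * (size g).-tuple bool}]).
split=> [|x]; first exact: undup_uniq.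
exists (rep (code f x, code g x)); first by rewrite mem_undup map_f // mem_enum.
have repE : (code f (rep (code f x, code g x)), code g (rep (code f x, code g x))) =
    (code f x, code g x).
  exact: (@xgetPex _ 0 [set y | (code f y, code g y) = (code f x, code g x)]
    (ex_intro _ x erefl)).
have repf := congr1 fst repE; have repg := congr1 snd repE.
by rewrite /= in repf repg; rewrite !argmax_code repf repg.
Qed.

Section Product.
Context (f g : trop_poly R) (f0 : f != [::]) (g0 : g != [::]).

Lemma tprod_neq0 : tprod f g != [::].
Proof. by rewrite -size_eq0 size_allpairs muln_eq0 !size_eq0 negb_or f0. Qed.

Lemma term_val_tprod t u x :
  term_val (t.1 + u.1, t.2 + u.2) x = term_val t x + term_val u x.
Proof. by rewrite /term_val /= zvecD dotpDl addrACA. Qed.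

Lemma teval_tprod x : teval (tprod f g) x = teval f x + teval g x.
Proof.
apply/eqP; rewrite eq_le; apply/andP; split.
  have [_ /allpairsP[[t u] /= [tf ug ->]] /eqP <-] := tight_exists x tprod_neq0.
  by rewrite term_val_tprod lerD // teval_ge.
have [t tf /eqP <-] := tight_exists x f0; have [u ug /eqP <-] := tight_exists x g0.
rewrite -term_val_tprod teval_ge //.
by apply/allpairsP; exists (t, u).
Qed.

(** A sum of two nonnegative slacks vanishes only when both do. This is the privileged
    representation at the level of exponents. *)
Lemma argmax_tprodP x c : c \in argmax (tprod f g) x <->
  exists a b, [/\ a \in argmax f x, b \in argmax g x & c = a + b].
Proof.
split=> [/argmaxP[_ /allpairsP[[t u] /= [tf ug ->]]]|
         [_ [_ [/argmaxP[t tf [/eqP tt <-]] /argmaxP[u ug [/eqP uu <-]] ->]]]].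
  rewrite /tight term_val_tprod teval_tprod => -[/eqP tu <-].
  have := teval_ge x tf; have := teval_ge x ug => h1 h2.
  exists t.1, u.1; split=> //; apply/argmaxP; [exists t|exists u] => //;
    by split=> //; apply/eqP; lra.
apply/argmaxP; exists (t.1 + u.1, t.2 + u.2); first by apply/allpairsP; exists (t, u).
by rewrite /tight term_val_tprod teval_tprod tt uu.
Qed.

Lemma dual_tprod_add x z w :
  dual f x z -> dual g x w -> dual (tprod f g) x (z + w).
Proof.
move=> /dualP fz /dualP gw; apply/dualP => v.
have [a af va] := fz v; have [b bg vb] := gw v.
exists (a + b); first by apply/argmax_tprodP; exists a, b.
by rewrite zvecD !dotpDr lerD.
Qed.

Lemma dual_tprodl x b : (forall c, c \in argmax g x -> c = b) ->
  forall z, dual (tprod f g) x z <-> dual f x (z - zvec R b).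
Proof.
move=> gb; have [b' b'g] := argmax_exists x g0; have bb' := gb _ b'g; subst b'.
move=> z; split=> [/dualP h|/dual_tprod_add/(_ (dual_mem b'g))]; last by rewrite subrK.
apply/dualP => v; have [_ /argmax_tprodP[a [c [af cg ->]]]] := h v.
by rewrite zvecD (gb _ cg) dotpDr dotpDr dotpNr => va; exists a => //; lra.
Qed.

Lemma dual_tprodr x a : (forall c, c \in argmax f x -> c = a) ->
  forall z, dual (tprod f g) x z <-> dual g x (z - zvec R a).
Proof.
move=> fa; have [a' a'f] := argmax_exists x f0; have aa' := fa _ a'f; subst a'.
move=> z; split=> [/dualP h|/(dual_tprod_add (dual_mem a'f))]; last by rewrite addrC subrK.
apply/dualP => v; have [_ /argmax_tprodP[c [b [cf bg ->]]]] := h v.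
by rewrite zvecD (fa _ cf) dotpDr dotpDr dotpNr => va; exists b => //; lra.
Qed.

End Product.

(** The working form of having dimension at most two: it covers the empty set and leads straight to
    volume zero. *)
Definition flat (S : set (pt R)) :=
  exists2 n, n != 0 & exists r, forall z, S z -> dotp n z = r.

Lemma flat_sub (S T : set (pt R)) : S `<=` T -> flat T -> flat S.
Proof. by move=> ST [n n0 [r h]]; exists n => //; exists r => z /ST /h. Qed.

(** At a common point both subgradient inequalities become equalities, which cut out a plane with
    normal [y - x]. *)
Lemma flat_overlap f x y : x != y -> flat (dual f x `&` dual f y).
Proof.
move=> xy; exists (y - x); first by rewrite subr_eq0 eq_sym.
by exists (teval f y - teval f x) => z [xz yz]; apply: dual_overlap.
Qed.

Lemma eq_argmax_flat f x y : x != y -> argmax f x =i argmax f y -> flat (dual f x).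
Proof.
move=> xy axy; apply: flat_sub (flat_overlap f xy).
by rewrite -(eq_dual axy) setIid.
Qed.

(** The product cell contains a translate of each factor's cell. *)
Lemma flat_tprod f g x : f != [::] -> g != [::] ->
  flat (dual (tprod f g) x) -> flat (dual f x) /\ flat (dual g x).
Proof.
move=> f0 g0 [n n0 [r nr]].
have [a af] := argmax_exists x f0; have [b bg] := argmax_exists x g0.
split; exists n => //; [exists (r - dotp n (zvec R b))|exists (r - dotp n (zvec R a))] => z.
  by move=> /(dual_tprod_add f0 g0)/(_ (dual_mem bg))/nr; rewrite dotpDr; lra.
by move=> /(dual_tprod_add f0 g0 (dual_mem af))/nr; rewrite dotpDr; lra.
Qed.

Lemma flat_single f x a : f != [::] -> (forall c, c \in argmax f x -> c = a) ->
  flat (dual f x).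
Proof.
move=> f0 fa; exists (const_mx 1).
  by apply/eqP => /rowP/(_ 0)/eqP; rewrite !mxE oner_eq0.
exists (dotp (const_mx 1) (zvec R a)) => z /dualP h; apply/le_anti.
have [_ /fa -> ->] := h (const_mx 1).
by have [_ /fa ->] := h (- const_mx 1); rewrite !dotpNl lerN2.
Qed.

(** A vector orthogonal to the [k] spanning differences defines a plane; a set that is not flat has
    a point off it, which adds one dimension. *)
Lemma affdim_ge_S (S : set (pt R)) k : (k < 3)%N -> ~ flat S ->
  affdim_ge S k -> affdim_ge S k.+1.
Proof.
move=> k3 Sflat [p [pS]]; set M := \matrix_(_, _) _ => rM.
(* Columns of the cokernel are orthogonal to all rows of [M]. *)
have [j nj] : exists j, col j (cokermx M) != 0.
  apply: contrapT => /forallNP h; have : \rank (cokermx M) != 0%N.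
    by rewrite mxrank_coker rM -lt0n subn_gt0.
  rewrite mxrank_eq0 => /eqP; apply; apply/matrixP => i l.
  have /negP/negPn/eqP/colP/(_ i) := h l; by rewrite !mxE.
pose n : pt R := (col j (cokermx M))^T.
have n0 : n != 0 by apply: contra nj => /eqP n0; rewrite -[col _ _]trmxK -/n n0 trmx0.
have [z Sz nz] : exists2 z, S z & dotp n z != dotp n (p ord0).
  apply: contrapT => /forall2NP h; apply: Sflat; exists n => //.
  by exists (dotp n (p ord0)) => z Sz; have [//|/negP/negPn/eqP] := h z.
(* The new point comes last, so that the base point of the differences stays [p ord0]. *)
pose q (i : 'I_k.+2) := if unlift ord_max i is Some i' then p i' else z.
have q_max : q ord_max = z by rewrite /q unlift_none.
have q_lift i : q (lift ord_max i) = p i by rewrite /q liftK.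
exists q; split=> [i|]; first by rewrite /q; case: unlift.
set M' := \matrix_(_, _) _.
have q0 : q ord0 = p ord0.
  by rewrite -q_lift; congr q; apply: val_inj.
have MM' : (M <= M')%MS.
  apply/row_subP => i.
  suff -> : row i M = row (lift ord_max i) M' by exact: row_sub.
  apply/rowP => l; rewrite !mxE q0; congr (_ - _).
  have -> : lift ord0 (lift ord_max i) = lift ord_max (lift ord0 i) :> 'I_k.+2.
    by apply: ord_inj; rewrite lift_max !lift0 lift_max.
  by rewrite q_lift.
have M'M : ~~ (M' <= M)%MS.
  apply: contraNN nz => /(submx_trans (row_sub ord_max M')).
  rewrite submxE => /eqP/matrixP/(_ 0 j); rewrite !mxE => h.
  rewrite -subr_eq0 -dotpNr -dotpDr dotpC -[X in _ == X]h; apply/eqP/eq_bigr => l _.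
  rewrite !mxE q0; congr ((_ - _) * _).
  have -> : lift ord0 ord_max = ord_max :> 'I_k.+2 by apply: ord_inj; rewrite lift0.
  by rewrite q_max.
have /rank_ltmx : (M < M')%MS by rewrite /ltmx MM'.
by rewrite rM => rM'; apply/eqP; rewrite eqn_leq rank_leq_row.
Qed.

Lemma affdim_ge0 (S : set (pt R)) z : S z -> affdim_ge S 0.
Proof.
by move=> Sz; exists (fun=> z); split=> //; apply/eqP; rewrite -leqn0 rank_leq_row.
Qed.

Lemma affdim_ge1 (S : set (pt R)) y z : S y -> S z -> y != z -> affdim_ge S 1.
Proof.
move=> Sy Sz yz; exists (fun i => if i == ord0 then y else z).
split=> [i|]; first by case: ifP.
apply/eqP; rewrite eqn_leq rank_leq_row lt0n mxrank_eq0 /=.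
apply: contra yz => /eqP/matrixP h; rewrite eq_sym -subr_eq0; apply/eqP/rowP => l.
by have := h 0 l; rewrite !mxE.
Qed.

Lemma affdim_ge1_inv (S : set (pt R)) : affdim_ge S 1 ->
  exists y z, [/\ S y, S z & y != z].
Proof.
move=> [p [pS]]; case: (eqVneq (p (lift ord0 ord0)) (p ord0)) => [e|]; last first.
  by exists (p (lift ord0 ord0)), (p ord0).
set M := \matrix_(_, _) _; suff -> : M = 0 by rewrite mxrank0.
by apply/matrixP => i l; rewrite !mxE (ord1 i) e subrr.
Qed.

Lemma affdim_ge_le3 (S : set (pt R)) k : affdim_ge S k -> (k <= 3)%N.
Proof. by move=> [p [_ <-]]; rewrite rank_leq_col. Qed.

Lemma affdim3 (S : set (pt R)) : ~ flat S -> affdim S 3.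
Proof.
move=> Sflat; split; last by move=> /affdim_ge_le3.
do 3![apply: affdim_ge_S => //].
have [z /affdim_ge0 //] : exists z, S z.
apply: contrapT => /forallNP S0; apply: Sflat.
exists (const_mx 1); first by apply/eqP => /rowP/(_ 0)/eqP; rewrite !mxE oner_eq0.
by exists 0 => z /S0.
Qed.

(** Transversality speaks of exact dimensions, so a lower bound is completed to one; the search ends
    because no dimension exceeds 3. *)
Lemma affdim_exists (S : set (pt R)) k : affdim_ge S k ->
  exists2 n, (k <= n)%N & affdim S n.
Proof.
have [m] := ubnP (4 - k)%N; elim: m k => // m ih k km Sk.
have k3 := affdim_ge_le3 Sk.
have [Sk1|] := pselect (affdim_ge S k.+1); last by exists k.
have [|n kn Sn] := ih k.+1 _ Sk1; last by exists n; rewrite // ltnW.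
by rewrite subnS -subn1 ltn_subLR ?subn_gt0 // add1n.
Qed.

Lemma affdim0P (S : set (pt R)) z : S z -> affdim S 0 <-> forall y, S y -> y = z.
Proof.
move=> Sz; split=> [[_ S1] y Sy|h].
  by apply: contrapT => /eqP yz; apply: S1; apply: affdim_ge1 yz.
split; first exact: affdim_ge0 Sz.
by move=> /affdim_ge1_inv[x [y [/h -> /h ->]]]; rewrite eqxx.
Qed.

(** * Transversality and vertices of the curve *)

Section Intersection.
Context (f g : trop_poly R) (f0 : f != [::]) (g0 : g != [::]).

Lemma dual_affdim_ge1 h x : h != [::] -> Vtr h x -> affdim_ge (dual h x) 1.
Proof.
move=> h0 /(VtrP _ h0)[a [b [/dual_mem ah /dual_mem bh ab]]].
apply: affdim_ge1 ah bh _; apply: contra ab => /eqP/zvec_inj ->.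
exact: eqxx.
Qed.

(** A three-dimensional factor cell makes the product cell three-dimensional too, and the dimension
    formula would read [3 = 3 + n] with [n >= 1]. *)
Lemma transversal_flat x : trop_transversal f g -> inter f g x ->
  flat (dual f x) /\ flat (dual g x).
Proof.
move=> [_ tr] xfg; have [fx gx] := xfg.
have [n1 n1_gt0 fn1] := affdim_exists (dual_affdim_ge1 f0 fx).
have [n2 n2_gt0 gn2] := affdim_exists (dual_affdim_ge1 g0 gx).
split; apply: contrapT => nflat.
  have /affdim3 p3 : ~ flat (dual (tprod f g) x) by move=> /(flat_tprod f0 g0)[].
  by have := tr x xfg _ _ _ p3 (affdim3 nflat) gn2; case: (n2) n2_gt0.
have /affdim3 p3 : ~ flat (dual (tprod f g) x) by move=> /(flat_tprod f0 g0)[].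
by have := tr x xfg _ _ _ p3 fn1 (affdim3 nflat); rewrite addnC; case: (n1) n1_gt0.
Qed.

(* If the dual cell lies in the plane [n . z = r], then the stratum contains
   [x + r n] for small [r]. *)
Lemma stratum_dim0 x : affdim (stratum f g x) 0 <-> ~ flat (dual (tprod f g) x).
Proof.
have xx : stratum f g x x by [].
split=> [/(affdim0P xx) sx [n n0 [r nr]]|nflat]; last first.
  apply/(affdim0P xx) => y [yf yg]; apply: contrapT => /eqP yx; apply: nflat.
  apply: (@eq_argmax_flat _ _ y) => [|c]; first by rewrite eq_sym.
  by apply/idP/idP => /(argmax_tprodP f0 g0)[a [b [af bg ->]]];
    apply/(argmax_tprodP f0 g0); exists a, b; rewrite ?yf ?yg // -yf -yg.
have near2 := @filterI _ _ (nbhs_filter x) _ _ (near_argmax x f0) (near_argmax x g0).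
have [s s0 [subf subg]] := near_ray n near2.
(* All maximal exponents have the same slope along [n], so one that remains maximal after the step
   takes the others with it. *)
have const h : (forall a b, a \in argmax h x -> b \in argmax h x ->
    dotp n (zvec R a) = dotp n (zvec R b)) -> h != [::] ->
    {subset argmax h (x + s *: n) <= argmax h x} ->
    argmax h (x + s *: n) =i argmax h x.
  move=> cst h0 sub a; apply/idP/idP => [/sub//|ax].
  have [b bh] := argmax_exists (x + s *: n) h0.
  apply: argmax_ray => //; have := argmax_dotp (sub _ bh) bh.
  by rewrite addrAC subrr add0r dotpZr !(dotpC _ n) (cst a b ax (sub _ bh)); lra.
have /sx/eqP : stratum f g x (x + s *: n).
  have [a af] := argmax_exists x f0; have [b bg] := argmax_exists x g0.
  split; apply: const => // c d cx dx.
    have := nr _ (dual_tprod_add f0 g0 (dual_mem cx) (dual_mem bg)).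
    by have := nr _ (dual_tprod_add f0 g0 (dual_mem dx) (dual_mem bg)); rewrite !dotpDr; lra.
  have := nr _ (dual_tprod_add f0 g0 (dual_mem af) (dual_mem cx)).
  by have := nr _ (dual_tprod_add f0 g0 (dual_mem af) (dual_mem dx)); rewrite !dotpDr; lra.
by rewrite -subr_eq0 addrAC subrr add0r scaler_eq0 (negPf n0) gt_eqF.
Qed.

End Intersection.

End DualSubdivision.

(** * Lebesgue measure of polytopes *)

Section NullAdditivity.
Local Open Scope ereal_scope.
Context d (T : measurableType d) (R : realType) (mu : {measure set T -> \bar R}).

Lemma measureU_null_overlap (A B : set T) : measurable A -> measurable B ->
  mu (A `&` B) = 0 -> mu (A `|` B) = mu A + mu B.
Proof.
move=> mA mB AB0; rewrite -[A `|` B](setDUK (@subsetUl _ A B)) setDUl setDv set0U.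
rewrite measureU //; [|exact: measurableD|].
  have -> : mu B = mu (B `\` A) + mu (A `&` B) by rewrite (setIC A); exact: measureDI.
  by rewrite AB0 adde0.
by rewrite setDE setICA setICr setI0.
Qed.

Lemma measure_bigU_null_overlap (I : eqType) (s : seq I) (F : I -> set T) :
  uniq s -> (forall i, measurable (F i)) ->
  (forall i j, i != j -> mu (F i `&` F j) = 0) ->
  mu (\big[setU/set0]_(i <- s) F i) = \sum_(i <- s) mu (F i).
Proof.
move=> us mF F0; elim: s us => [|i s ih] /= => [_|/andP[si /ih {}ih]].
  by rewrite !big_nil measure0.
have mU (r : seq I) : measurable (\big[setU/set0]_(j <- r) F j).
  by apply: bigsetU_measurable => j _.
rewrite !big_cons measureU_null_overlap ?ih //.
elim: s si {ih} => [_|j s ih]; first by rewrite big_nil setI0 measure0.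
rewrite inE negb_or big_cons setIUr => /andP[ij /ih si].
by apply: null_set_setU; rewrite ?F0 //; apply: measurableI.
Qed.

End NullAdditivity.

Section Lebesgue3.
Context (R : realType).
Implicit Types (v : pt R) (S : set (pt R)).
Local Notation leb := (@lebesgue_measure R).
Local Notation leb2 := (leb \x leb)%E.
Local Notation leb3 := (leb2 \x leb)%E.

Lemma ord3_cases (i : 'I_3) : i = 0 \/ i = 1 \/ i = 2.
Proof.
by case: i => [[|[|[|//]]] hi]; [left|right; left|right; right]; apply: val_inj.
Qed.

Lemma dotp_to_pt v (q : R * R * R) :
  dotp v (to_pt q) = v 0 0 * q.1.1 + v 0 1 * q.1.2 + v 0 2 * q.2.
Proof.
rewrite /dotp !big_ord_recl big_ord0 addr0 addrA !mxE /=.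
by congr (_ * _ + _ * _ + _ * _); congr (fun_of_matrix _ _ _); apply: val_inj.
Qed.

Lemma measurable_dotp v :
  measurable_fun [set: R * R * R] (fun q => dotp v (to_pt q)).
Proof.
under eq_fun do rewrite dotp_to_pt.
apply: measurable_funD; first apply: measurable_funD.
- apply: measurable_funM; first exact: measurable_cst.
  exact: (measurableT_comp measurable_fst measurable_fst).
- apply: measurable_funM; first exact: measurable_cst.
  exact: (measurableT_comp measurable_snd measurable_fst).
- by apply: measurable_funM; first exact: measurable_cst.
Qed.

(** Points are row vectors while the measure lives on triples, hence the preimage. *)
Definition mset S := measurable (@to_pt R @^-1` S : set (R * R * R)).

Lemma mset_halfspace v (r : R) : mset [set x | dotp v x <= r].
Proof.
rewrite /mset -[X in measurable X]setTI.
exact: (measurable_dotp v measurableT (measurable_itv `]-oo, r])).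
Qed.

Lemma mset_hyperplane v (r : R) : mset [set x | dotp v x = r].
Proof.
rewrite /mset -[X in measurable X]setTI.
exact: (measurable_dotp v measurableT (measurable_set1 r)).
Qed.

Lemma leb2_line (a b c : R) : (a != 0) || (b != 0) ->
  leb2 [set q | a * q.1 + b * q.2 = c] = 0%E.
Proof.
case: (eqVneq b 0) => [->|b0] /=; last first.
  move=> _; apply: integral0_eq => x _ /=.
  rewrite (_ : xsection _ _ = [set (c - a * x) / b]) ?lebesgue_measure_set1 //.
  apply/seteqP; split=> y; rewrite /xsection /= inE /=.
    by move=> <-; rewrite addrAC subrr add0r mulrAC divff ?mul1r.
  by move=> ->; rewrite mulrCA divff // mulr1 addrC subrK.
rewrite orbF => a0.
rewrite (_ : [set _ | _] = [set c / a] `*` [set: R]).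
  by rewrite product_measure1E //= lebesgue_measure_set1 mul0e.
apply/seteqP; split=> -[x y] /=; rewrite mul0r addr0.
  by move=> <-; split=> //; rewrite mulrAC divff ?mul1r.
by move=> [-> _]; rewrite mulrCA divff // mulr1.
Qed.

(** Either every section along the last coordinate is a single point, or the plane is a cylinder
    over a line. *)
Lemma leb3_plane v (r : R) : v != 0 -> vol3 [set x | dotp v x = r] = 0%E.
Proof.
move=> v0; rewrite /vol3.
rewrite (_ : _ @^-1` _ = [set q : R * R * R |
    v 0 0 * q.1.1 + v 0 1 * q.1.2 + v 0 2 * q.2 = r]); last first.
  by apply/seteqP; split=> q /=; rewrite dotp_to_pt.
have [v2|v2] := eqVneq (v 0 2) 0; last first.
  apply: integral0_eq => -[x y] _ /=; set s := v 0 0 * x + v 0 1 * y.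
  rewrite (_ : xsection _ _ = [set (r - s) / v 0 2]) ?lebesgue_measure_set1 //.
  apply/seteqP; split=> z; rewrite /xsection /= inE /= -/s.
    by move=> <-; rewrite addrAC subrr add0r mulrAC divff ?mul1r.
  by move=> ->; rewrite mulrCA divff // mulr1 addrC subrK.
pose B := [set q : R * R | v 0 0 * q.1 + v 0 1 * q.2 = r].
rewrite (_ : [set _ | _] = B `*` [set: R]); last first.
  apply/seteqP; split=> -[[x y] z] /=; rewrite v2 mul0r addr0 //.
  by move=> [].
have mB : measurable B.
  have mF : measurable_fun setT (fun q : R * R => v 0 0 * q.1 + v 0 1 * q.2).
    by apply: measurable_funD; apply: measurable_funM => //; exact: measurable_cst.
  by rewrite -[B]setTI; exact: (mF measurableT _ (measurable_set1 r)).
rewrite product_measure1E //= leb2_line ?mul0e //.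
apply: contraNT v0; rewrite negb_or !negbK => /andP[/eqP v00 /eqP v01].
apply/eqP/rowP => i; rewrite mxE.
by case: (ord3_cases i) => [->|[->|->]].
Qed.

Lemma vol_flat S : mset S -> flat S -> vol3 S = 0%E.
Proof.
move=> mS [n n0 [r nr]]; apply: subset_measure0 (leb3_plane r n0) => //.
  exact: mset_hyperplane.
by move=> q /nr.
Qed.

(* Integer normals suffice, so a hull is a countable intersection of finite
   unions of half-spaces, hence measurable. *)
Lemma conv_integer_support (s : seq (pt R)) x :
  (forall u : expo, exists2 a, a \in s & dotp (zvec R u) x <= dotp (zvec R u) a) ->
  Defs.conv s x.
Proof.
move=> h; apply/conv_support => v; apply: contrapT => /forall2NP sv.
have gap a : a \in s -> 0 < dotp v (x - a).
  move=> as_; rewrite dotpDr dotpNr subr_gt0 ltNge; apply/negP.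
  by case: (sv a) => // /(_ as_).
(* [K a] bounds the error of rounding the normal down to integers, as each coordinate moves by less
   than one. [N] scales [v] until the gap beats this error for every [a]. *)
pose K a := \sum_(i < 3) `|(x - a) 0 i|.
have K0 a : 0 <= K a by apply: sumr_ge0.
pose N := 1 + \sum_(a <- s | a \in s) K a / dotp v (x - a).
have N_gap a : a \in s -> K a < N * dotp v (x - a).
  move=> as_; rewrite -ltr_pdivrMr ?gap // /N (big_rem a) //= as_.
  have : 0 <= \sum_(y <- rem a s | y \in s) K y / dotp v (x - y).
    by apply: sumr_ge0 => y ys; rewrite divr_ge0 // ltW // gap.
  lra.
have [a as_] := h (\row_i Num.floor (N * v 0 i)).
rewrite -subr_le0 -dotpNr -dotpDr => ua.
have := N_gap a as_; rewrite ltNge => /negP; apply.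
set u := \row_i _ in ua.
have : dotp (N *: v - zvec R u) (x - a) <= K a.
  apply: ler_sum => i _; set y := (x - a) 0 i; rewrite !mxE.
  apply: le_trans (ler_norm _) _; rewrite normrM ler_piMl //.
  rewrite ger0_norm ?subr_ge0 ?floor_le // lerBlDr addrC.
  by rewrite -(intrD _ _ 1) ltW // floorD1_gt.
by rewrite dotpDl dotpNl dotpZl; lra.
Qed.

Lemma mset_conv (s : seq (pt R)) : mset (Defs.conv s).
Proof.
pose H (u : expo) : set (pt R) :=
  \big[setU/set0]_(a <- s) [set x | dotp (zvec R u) x <= dotp (zvec R u) a].
(* An index that decodes to no integer vector contributes the whole space. *)
pose F n := @to_pt R @^-1` (if unpickle n is Some u then H u else setT).
suff : @to_pt R @^-1` Defs.conv s = \bigcap_n F n.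
  rewrite /mset => ->; apply: bigcapT_measurable => n; rewrite /F.
  case: unpickle => [u|]; last by rewrite preimage_setT.
  rewrite /H; elim: s {H F} => [|a s ih]; first by rewrite big_nil preimage_set0.
  by rewrite big_cons preimage_setU; apply: measurableU => //; apply: mset_halfspace.
have HP u x : H u x <-> exists2 a, a \in s & dotp (zvec R u) x <= dotp (zvec R u) a.
  by rewrite /H -bigcup_seq; split=> -[a]; exists a.
apply/seteqP; split=> q /=.
  move=> /conv_support h n _; rewrite /F /=; case: unpickle => // u.
  exact/HP.
move=> h; apply: conv_integer_support => u; apply/HP.
by have := h (pickle u) I; rewrite /F /= pickleK.
Qed.

Local Notation pushforward_measure :=
  measure_function_pushforward__canonical__measure_function_Measure.

(** The translated measure gives half-open intervals their length, which determines Lebesgue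
    measure. *)
Lemma leb_shift (t : R) (A : set R) : measurable A -> leb (+%R^~ t @^-1` A) = leb A.
Proof.
move=> mA; have mt : measurable_fun [set: R] (+%R^~ t : R -> R).
  by apply: measurable_funD => //; exact: measurable_cst.
apply/esym.
have {}mt : measurable_fun (T := measurableTypeR R) (U := measurableTypeR R) setT
  (+%R^~ t) := mt.
refine (@lebesgue_measure_unique R (pushforward_measure leb mt) _ A mA) => _ [[a b] _ <-].
change (leb `]a, b]%classic = leb (+%R^~ t @^-1` `]a, b]%classic)).
rewrite (_ : _ @^-1` _ = `]a - t, b - t]%classic); last first.
  by apply/seteqP; split=> x /=; rewrite !in_itv /= ltrBlDr lerBrDr.
rewrite !lebesgue_measure_itv /= !lte_fin ltrD2r.
by case: ifP => // _; rewrite -!EFinB; congr (_%:E); lra.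
Qed.

End Lebesgue3.

Section ProductPreserving.
Local Open Scope ereal_scope.
Local Notation pushforward_measure :=
  measure_function_pushforward__canonical__measure_function_Measure.
Context d1 d2 (T1 : measurableType d1) (T2 : measurableType d2) (R : realType).
Context (m1 : {sigma_finite_measure set T1 -> \bar R}).
Context (m2 : {sigma_finite_measure set T2 -> \bar R}).
Context (f1 : T1 -> T1) (f2 : T2 -> T2).
Hypothesis mf1 : measurable_fun setT f1.
Hypothesis mf2 : measurable_fun setT f2.
Hypothesis f1_preserves : forall A, measurable A -> m1 (f1 @^-1` A) = m1 A.
Hypothesis f2_preserves : forall A, measurable A -> m2 (f2 @^-1` A) = m2 A.

Let f (q : T1 * T2) := (f1 q.1, f2 q.2).

Lemma measurable_prod_map : measurable_fun setT f.
Proof. by apply: measurable_fun_pair; exact: measurableT_comp. Qed.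

(** The pushforward agrees with the product measure on rectangles, so uniqueness applies. *)
Lemma product_measure_preserving A : measurable A ->
  (m1 \x m2) (f @^-1` A) = (m1 \x m2) A.
Proof.
move=> mA; apply/esym.
refine (@product_measure_unique _ _ _ _ _ _ _
  (pushforward_measure (m1 \x m2) measurable_prod_map) _ A mA) => B C mB mC.
change ((m1 \x m2) ((f1 @^-1` B) `*` (f2 @^-1` C)) = m1 B * m2 C).
have mB' : measurable (f1 @^-1` B) by rewrite -[X in measurable X]setTI; exact: mf1.
have mC' : measurable (f2 @^-1` C) by rewrite -[X in measurable X]setTI; exact: mf2.
by rewrite product_measure1E //= f1_preserves // f2_preserves.
Qed.

End ProductPreserving.

(* The library has no usable canonical sigma-finite structure on a product of
   sigma-finite measures, hence this renaming of the planar Lebesgue measure. *)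
Section PlanarMeasure.
Local Open Scope ereal_scope.
Context (R : realType).

Definition planar_measure := (@lebesgue_measure R \x @lebesgue_measure R).

HB.instance Definition _ := Measure.on planar_measure.

Lemma planar_measure_sigma_finite : sigma_finite setT planar_measure.
Proof.
pose I n : set R := [set` (`[- n%:R, n%:R]%R : interval R)].
exists (fun n => I n `*` I n).
  apply/seteqP; split=> // -[x y] _; pose n := Num.bound (`|x| + `|y|)%R.
  have n_gt : (`|x| + `|y| < n%:R)%R by apply: archi_boundP; rewrite addr_ge0.
  exists n => //; split; rewrite /I /= in_itv /= -ler_norml ltW //.
    by apply: le_lt_trans n_gt; rewrite lerDl.
  by apply: le_lt_trans n_gt; rewrite lerDr.
move=> n; have mI : measurable (I n) by exact: measurable_itv.
split; first exact: measurableX.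
rewrite /planar_measure product_measure1E //= !lebesgue_measure_itv /=.
by case: ifP => _; rewrite ?mule0 ?ltry // -EFinM ltry.
Qed.

HB.instance Definition _ :=
  Measure_isSigmaFinite.Build _ _ _ planar_measure planar_measure_sigma_finite.

End PlanarMeasure.

(** * Translation invariance and the volume of a simplex *)

Section Volumes.
Context (R : realType).
Implicit Types (v : pt R) (S : set (pt R)).
Local Notation leb := (@lebesgue_measure R).
Local Notation leb2 := (@planar_measure R).
Local Notation leb3 := (leb2 \x leb)%E.

Lemma to_pt_onto v : to_pt (v 0 0, v 0 1, v 0 2) = v.
Proof.
by apply/rowP => i; rewrite mxE; case: (ord3_cases i) => [->|[->|->]].
Qed.

Lemma to_ptD (p q : R * R * R) :
  to_pt p + to_pt q = to_pt (p.1.1 + q.1.1, p.1.2 + q.1.2, p.2 + q.2).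
Proof.
by apply/rowP => i; rewrite !mxE; case: (ord3_cases i) => [->|[->|->]].
Qed.

Lemma vol_shift S v : mset S -> vol3 [set z | S (z + v)] = vol3 S.
Proof.
move=> mS; rewrite /vol3.
have mt (t : R) : measurable_fun (T := measurableTypeR R) (U := measurableTypeR R)
    setT (+%R^~ t).
  by apply: measurable_funD => //; exact: measurable_cst.
have p2 := product_measure_preserving (mt (v 0 0)) (mt (v 0 1))
  (leb_shift _) (leb_shift _).
have p3 := product_measure_preserving
  (m1 := [the {sigma_finite_measure set _ -> \bar R} of @planar_measure R]) (m2 := leb)
  (measurable_prod_map (mt (v 0 0)) (mt (v 0 1))) (mt (v 0 2)) p2 (leb_shift _).
have tv (q : R * R * R) : to_pt q + v = to_pt (q.1.1 + v 0 0, q.1.2 + v 0 1, q.2 + v 0 2).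
  by rewrite -[in LHS](to_pt_onto v) to_ptD.
by rewrite -[RHS]p3 //; congr (leb3 _); apply/seteqP; split=> q /=; rewrite tv.
Qed.

(** The fundamental theorem of calculus; the degenerate interval [s = 0] is treated apart. *)
Lemma integral_poly (p : {poly R}) (s : R) : 0 <= s ->
  (\int[leb]_(x in `[0%R, s]) (p^`().[x])%:E)%E = (p.[s] - p.[0])%:E.
Proof.
rewrite le_eqVlt => /predU1P[<-|s0].
  by rewrite set_itv1 integral_set1 subrr.
rewrite (@continuous_FTC2 _ _ (horner p)) //.
- by apply/continuous_subspaceT => x; exact: continuous_horner.
- split=> [x _| |].
  + exact: derivable_horner.
  + by apply: cvg_at_right_filter; exact: continuous_horner.
  + by apply: cvg_at_left_filter; exact: continuous_horner.
- by move=> x _; rewrite derivE.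
Qed.

Lemma leb2_triangle (s : R) : 0 <= s ->
  leb2 [set q | [/\ 0 <= q.1, 0 <= q.2 & q.1 + q.2 <= s]] = (s ^+ 2 / 2)%:E.
Proof.
move=> s0; pose p : {poly R} := s *: 'X - 2^-1 *: 'X^2.
have pE x : p^`().[x] = s - x.
  rewrite /p !poly.derivE !hornerE /=; lra.
transitivity (\int[leb]_(x in `[0%R, s]) (p^`().[x])%:E)%E; last first.
  rewrite integral_poly // /p !hornerE /=; congr (_%:E); lra.
rewrite [RHS]integral_mkcond; apply: eq_integral => x _ /=.
rewrite patchE; case: ifPn => [|xs].
  rewrite inE /= in_itv /= => /andP[x0 xs].
  rewrite (_ : xsection _ _ = `[0, s - x]%classic).
    rewrite lebesgue_measure_itv /= lte_fin pE; case: ifPn => [_|].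
      by rewrite -EFinB subr0.
    by rewrite -leNgt => sx; congr (_%:E); lra.
  apply/seteqP; split=> y; rewrite /xsection /= inE /= in_itv /=.
    by move=> [_ -> ?]; rewrite lerBrDl.
  by move=> /andP[-> ?]; split=> //; rewrite -lerBrDl.
rewrite (_ : xsection _ _ = set0) ?measure0 //.
apply/seteqP; split=> y //; rewrite /xsection /= inE /= => -[x0 y0 xys].
case/negP: xs; rewrite inE /= in_itv /= x0 /=; lra.
Qed.

(** The slice at height [z] is a triangle of size [s - z], whose area is then integrated. *)
Lemma leb3_tetrahedron (s : R) : 0 <= s ->
  measurable [set q : R * R * R |
    [/\ 0 <= q.1.1, 0 <= q.1.2, 0 <= q.2 & q.1.1 + q.1.2 + q.2 <= s]] ->
  leb3 [set q | [/\ 0 <= q.1.1, 0 <= q.1.2, 0 <= q.2 &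
                    q.1.1 + q.1.2 + q.2 <= s]] = (s ^+ 3 / 6)%:E.
Proof.
move=> s0 mT; set T := [set _ | _] in mT *.
(* The last coordinate becomes the outer variable of integration, so that slices are planar. *)
have -> : leb3 T = (leb2 \x^ leb)%E T.
  by apply: product_measure_unique => //= *; rewrite product_measure2E.
pose p : {poly R} := (s ^+ 2 / 2) *: 'X - (s / 2) *: 'X^2 + 6^-1 *: 'X^3.
have pE z : p^`().[z] = (s - z) ^+ 2 / 2.
  rewrite /p !poly.derivE !hornerE /=; lra.
transitivity (\int[leb]_(z in `[0%R, s]) (p^`().[z])%:E)%E; last first.
  rewrite integral_poly // /p !hornerE /=; congr (_%:E); lra.
rewrite [RHS]integral_mkcond; apply: eq_integral => z _ /=.
rewrite patchE; case: ifPn => [|zs].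
  rewrite inE /= in_itv /= => /andP[z0 zs].
  rewrite pE -leb2_triangle ?subr_ge0 //; congr (leb2 _).
  apply/seteqP; split=> -[x y]; rewrite /ysection /= inE /T /=.
    by move=> [-> -> _ ?]; split=> //; rewrite lerBrDr.
  by move=> [-> -> ?]; split=> //; rewrite -lerBrDr.
rewrite (_ : ysection _ _ = set0) ?measure0 //.
apply/seteqP; split=> -[x y] //; rewrite /ysection /= inE /T /= => -[x0 y0 z0 xys].
case/negP: zs; rewrite inE /= in_itv /= z0 /=; lra.
Qed.

End Volumes.

(** * Counting volumes *)

Section DegreeCount.
Context (R : realType).
Implicit Types (f g h : trop_poly R) (x y z v : pt R) (S : seq (pt R)).

Lemma dotp_dvert v d i : dotp v (dvert R d i) = d%:R * v 0 i.
Proof.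
rewrite /dotp (bigD1 i) //= big1 => [|j /negPf ji]; rewrite mxE ?eqxx ?ji ?mulr0 //.
by rewrite addr0 mulrC.
Qed.

Lemma dvert_vertices d i :
  dvert R d i \in [:: 0; dvert R d 0; dvert R d 1; dvert R d 2].
Proof. by rewrite !inE; case: (ord3_cases i) => [->|[->|->]]; rewrite eqxx ?orbT. Qed.

(** The normals [- delta_mx 0 i] and [const_mx 1] give the facets; conversely a functional is
    largest at 0 or at the vertex of its largest coordinate. *)
Lemma Gamma3P d x : @Gamma3 R d x <-> (forall i, 0 <= x 0 i) /\ \sum_i x 0 i <= d%:R.
Proof.
have dotp1 y : dotp (const_mx 1) y = \sum_i y 0 i.
  by apply: eq_bigr => i _; rewrite mxE mul1r.
have dotp_delta i y : dotp (- delta_mx 0 i) y = - y 0 i.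
  rewrite dotpNl; congr (- _); rewrite /dotp (bigD1 i) //= big1 => [|j /negPf ji].
    by rewrite mxE !eqxx mul1r addr0.
  by rewrite mxE ji andbF mul0r.
have vertexP v a : a \in [:: 0; dvert R d 0; dvert R d 1; dvert R d 2] ->
    dotp v a = 0 \/ exists i, dotp v a = d%:R * v 0 i.
  rewrite !inE => /or4P[] /eqP->; [by left; rewrite dotp0r|right..];
    by eexists; exact: dotp_dvert.
split=> [/conv_support h|[x0 xd]]; last apply/conv_support => v.
  split=> [i|].
    have [a /(vertexP (- delta_mx 0 i)) va] := h (- delta_mx 0 i).
    rewrite (dotp_delta _ x); case: va => [->|[j ->]]; first by rewrite oppr_le0.
    move=> xi; rewrite -oppr_le0; apply: le_trans xi _.
    by rewrite !mxE mulrN oppr_le0 mulr_ge0.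
  have [a /(vertexP (const_mx 1)) va] := h (const_mx 1).
  rewrite (dotp1 x); case: va => [->|[j ->]]; rewrite ?mxE ?mulr1 // => /le_trans; exact.
have [i _ vi] := @arg_maxP _ _ _ (0 : 'I_3) xpredT (fun i => v 0 i) isT.
have vx : dotp v x <= v 0 i * \sum_j x 0 j.
  by rewrite mulr_sumr; apply: ler_sum => j _; rewrite ler_wpM2r //; exact: vi.
have [vi0|vi0] := leP (v 0 i) 0.
  exists 0; rewrite ?mem_head // dotp0r; apply: le_trans vx _.
  by rewrite mulr_le0_ge0 // sumr_ge0.
exists (dvert R d i); first exact: dvert_vertices.
by rewrite dotp_dvert mulrC; apply: le_trans vx _; rewrite ler_wpM2l // ltW.
Qed.

Lemma vol_Gamma3 d : vol3 (@Gamma3 R d) = (d%:R ^+ 3 / 6)%:E.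
Proof.
have E : @to_pt R @^-1` @Gamma3 R d = [set q : R * R * R |
    [/\ 0 <= q.1.1, 0 <= q.1.2, 0 <= q.2 & q.1.1 + q.1.2 + q.2 <= d%:R]].
  apply/seteqP; split=> q /=; rewrite Gamma3P !big_ord_recl big_ord0 addr0 addrA !mxE /=.
    by move=> [q0 qd]; have := (q0 0, q0 1, q0 2); rewrite !mxE /= => -[[? ?] ?].
  by move=> [? ? ? ?]; split=> // i; case: (ord3_cases i) => [->|[->|->]]; rewrite mxE.
rewrite /vol3 E; apply: leb3_tetrahedron => //.
by rewrite -E; exact: mset_conv.
Qed.

Lemma newton_tprod f g d e : newton f = @Gamma3 R d -> newton g = @Gamma3 R e ->
  newton (tprod f g) = @Gamma3 R (d + e).
Proof.
move=> fd ge; have exp_f t : t \in f -> @Gamma3 R d (zvec R t.1).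
  by move=> tf; rewrite -fd; apply/newtonP => v; exists t.
have exp_g t : t \in g -> @Gamma3 R e (zvec R t.1).
  by move=> tg; rewrite -ge; apply/newtonP => v; exists t.
apply/seteqP; split=> x.
  move=> /newtonP h; apply/conv_support => v.
  have [_ /allpairsP[[t u] /= [/exp_f tf /exp_g ug ->]] /= vx] := h v.
  suff /conv_support/(_ v)[a as_ va] : @Gamma3 R (d + e) (zvec R (t.1 + u.1)).
    by exists a => //; apply: le_trans vx va.
  move: tf ug; rewrite !Gamma3P => -[t0 td] [u0 ue].
  split=> [i|]; first by rewrite zvecD mxE addr_ge0.
  rewrite natrD; apply: le_trans (lerD td ue).
  by rewrite -big_split /=; apply: ler_sum => i _; rewrite zvecD [leLHS]mxE.
move=> /Gamma3P[x0 xde].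
(* A point of the large simplex is split in proportion [d] to [e]. If [d + e = 0] the ratio is 0 by
   the convention for division. *)
pose r : R := d%:R / (d + e)%:R.
have [r0 r1] : 0 <= r /\ r <= 1.
  split; first by rewrite divr_ge0.
  rewrite /r; have [->|de] := eqVneq (d + e)%N 0%N; first by rewrite invr0 mulr0.
  by rewrite ler_pdivrMr ?ltr0n ?lt0n // mul1r ler_nat leq_addr.
have sumZ (c : R) : \sum_i (c *: x) 0 i = c * \sum_i x 0 i.
  by rewrite mulr_sumr; apply: eq_bigr => i _; rewrite mxE.
have sum_ge0 : 0 <= \sum_i x 0 i by apply: sumr_ge0.
have [rd re] : r * (d + e)%:R <= d%:R /\ (1 - r) * (d + e)%:R <= e%:R :> R.
  rewrite /r; have [de|de] := eqVneq (d + e)%N 0%N; first by rewrite de !mulr0.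
  have de0 : (d + e)%:R != 0 :> R by rewrite pnatr_eq0.
  by rewrite mulrBl divfK // mul1r natrD; split; lra.
have : newton f (r *: x).
  rewrite fd Gamma3P; split=> [i|]; first by rewrite mxE mulr_ge0.
  by rewrite sumZ; apply: le_trans rd; rewrite ler_wpM2l.
have : newton g ((1 - r) *: x).
  rewrite ge Gamma3P; split=> [i|]; first by rewrite mxE mulr_ge0 // subr_ge0.
  by rewrite sumZ; apply: le_trans re; rewrite ler_wpM2l // subr_ge0.
move=> /newtonP gx /newtonP fx; apply/newtonP => v.
have [t tf vt] := fx v; have [u ug vu] := gx v.
exists (t.1 + u.1, t.2 + u.2); first by apply/allpairsP; exists (t, u).
rewrite /= zvecD dotpDr; apply: le_trans (lerD vt vu).
by rewrite -dotpDr -scalerDl addrC subrK scale1r.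
Qed.

(** The cells cover the Newton polytope, and distinct points have cells overlapping in a null set,
    even when the two cells coincide. *)
Lemma vol_newton f S : uniq S ->
  (forall x, exists2 y, y \in S & argmax f y =i argmax f x) ->
  vol3 (newton f) = (\sum_(x <- S) vol3 (dual f x))%E.
Proof.
move=> uS repS; pose F x := @to_pt R @^-1` dual f x.
have FE : @to_pt R @^-1` newton f = \big[setU/set0]_(x <- S) F x.
  rewrite -bigcup_seq; apply/seteqP.
  split=> [q /= /dual_cover[x xz]|q [x _ /dual_newton //]].
  have [y yS yx] := repS x; exists y => //.
  by rewrite /F /= (@eq_dual _ _ y x).
rewrite /vol3 FE.
apply: (@measure_bigU_null_overlap _ _ _
  [the measure _ _ of (@planar_measure R \x @lebesgue_measure R)%E] _ S F uS) => [x|x y xy].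
  exact: mset_conv.
apply: vol_flat (flat_overlap _ xy).
by apply: measurableI; exact: mset_conv.
Qed.

Lemma vol_translate (A B : set (pt R)) v :
  mset B -> (forall z, A z <-> B (z - v)) -> vol3 A = vol3 B.
Proof.
move=> mB AB; rewrite -(vol_shift (- v) mB); congr vol3.
by apply/seteqP; split=> z /=; rewrite AB.
Qed.

End DegreeCount.

Unset Implicit Arguments.

Theorem theorem3p2 (R : realType) (f g : trop_poly R) (d e : nat) :
  smooth_deg f d -> smooth_deg g e -> trop_transversal f g ->
  exists s : seq (pt R),
    uniq s /\ (forall P : pt R, P \in s <-> curve_vertex f g P) /\
    (\sum_(P <- s) mult f g P)%E = ((d * e * (d + e))%N%:R)%:E.
Proof.
move=> [fd _] [ge _] tr.
(* Without terms the Newton polytope would be empty, but the simplex contains 0. *)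
have nonempty (h : trop_poly R) k : newton h = Gamma3 k -> h != [::].
  move=> hk; have : newton h 0 by rewrite hk Gamma3P; split=> [i|];
    rewrite ?big1 // => *; rewrite mxE.
  by move=> /newtonP/(_ 0)[t]; case: (h).
have f0 := nonempty _ _ fd; have g0 := nonempty _ _ ge.
pose h := tprod f g.
have [S [uS repS]] := cell_representatives f g.
have rep_h x : exists2 y, y \in S & argmax h y =i argmax h x.
  have [y yS [yf yg]] := repS x; exists y => // c.
  by apply/idP/idP => /(argmax_tprodP f0 g0)[a [b [af bg ->]]];
    apply/(argmax_tprodP f0 g0); exists a, b; rewrite ?yf ?yg // -yf -yg.
pose vertex P := `[< curve_vertex f g P >].
exists [seq P <- S | vertex P]; split; first exact: filter_uniq.
have vertexE P : curve_vertex f g P <-> inter f g P /\ ~ flat (dual h P).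
  by rewrite /curve_vertex stratum_dim0.
split=> [P|].
  rewrite mem_filter; split=> [/andP[/asboolP]//|vP].
  apply/andP; split; first exact/asboolP.
  (* The representative of a vertex is the vertex itself, since two points sharing a cell force it
     to be flat. *)
  have [y yS yP] := rep_h P; have [<-//|yP'] := eqVneq y P.
  have [_ []] := (vertexE P).1 vP.
  by rewrite -(eq_dual yP); exact: eq_argmax_flat yP' yP.
have single (k : trop_poly R) x : k != [::] -> ~ Vtr k x ->
    exists2 a, a \in argmax k x & forall c, c \in argmax k x -> c = a.
  move=> k0 kx; have [a ak] := argmax_exists x k0; exists a => // c ck.
  by apply: contrapT => /eqP ca; apply: kx; apply/VtrP => //; exists c, a.
have vol_flat_dual (k : trop_poly R) x : flat (dual k x) -> vol3 (dual k x) = 0%E.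
  exact: vol_flat (mset_conv _).
(* A three-dimensional cell of Subdiv(h) is dual to a vertex of the curve, or
   is a translate of a cell of Subdiv(f) or of Subdiv(g). *)
have cell_vol P : vol3 (dual h P) =
    ((if vertex P then vol3 (dual h P) else 0) +
     (vol3 (dual f P) + vol3 (dual g P)))%E.
  have [Pfg|Pfg] := pselect (inter f g P).
    have [fl gl] := transversal_flat f0 g0 tr Pfg.
    rewrite (vol_flat_dual f) // (vol_flat_dual g) // !adde0.
    case: ifPn => // /asboolPn nP; apply: vol_flat_dual; apply: contrapT => hl.
    by apply: nP; apply/vertexE.
  (* Off the curve one factor has a single maximal exponent: its own cell is flat, and the product
     cell is a translate of the other factor's cell. *)
  rewrite ifN; last by apply/asboolPn => /vertexE[].
  rewrite add0e; have [fP|fP] := pselect (Vtr f P).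
    have [|b bg sb] := single g P g0; first by move=> gP; apply: Pfg.
    rewrite (vol_flat_dual g) ?adde0; last exact: flat_single sb.
    exact: vol_translate (mset_conv _) (dual_tprodl f0 g0 sb).
  have [a af sa] := single f P f0 fP.
  rewrite (vol_flat_dual f) ?add0e; last exact: flat_single sa.
  exact: vol_translate (mset_conv _) (dual_tprodr f0 g0 sa).
have total : (\sum_(P <- S) vol3 (dual h P) =
    \sum_(P <- S | vertex P) vol3 (dual h P) + (vol3 (newton f) + vol3 (newton g)))%E.
  rewrite (vol_newton uS) => [|x]; last first.
    by have [y yS [yf _]] := repS x; exists y => // c; rewrite yf.
  rewrite (vol_newton uS) => [|x]; last first.
    by have [y yS [_ yg]] := repS x; exists y => // c; rewrite yg.
  by rewrite [in RHS]big_mkcond -!big_split; apply: eq_bigr => P _; exact: cell_vol.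
move: total; rewrite -(vol_newton uS rep_h) fd ge (newton_tprod fd ge) !vol_Gamma3.
rewrite /mult big_filter -ge0_sume_distrr; last first.
  by move=> P _; exact: measure_ge0.
(* The total volume is finite, which rules out infinite values. What remains is
   [(d + e)^3 / 6 = r + d^3 / 6 + e^3 / 6], with the claim about [2 * r]. *)
case: (\sum_(P <- S | vertex P) vol3 (dual h P))%E => [r| |] //.
rewrite -!EFinD -EFinM => -[hr]; congr (_%:E).
rewrite !natrM !natrD in hr *.
have -> : r = ((d%:R + e%:R) ^+ 3 - d%:R ^+ 3 - e%:R ^+ 3) / 6 by lra.
by field.
Qed.
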